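(* Let $R$ be an associative ring with unity $1$ and let $a,b,c,w,v\in R$. Then the following statements are equivalent: (i) $y=a^{v,w}_{b,c}$, that is, $y$ is the $(v,w)$-weighted $(b,c)$-inverse of $a$. (ii) $yvawy=y$, $yvR=bR$ and $Rwy=Rc$. (iii) $yvawy=y$, $lann(yv)=lann(b)$, $Rwy=Rc$, and $b$ is regular. (iv) $yvawy=y$, $yvR=bR$, $rann(wy)=rann(c)$, and $c$ is regular. (v) $yvawy=y$, $lann(yv)=lann(b)$ and $rann(wy)=rann(c)$, and both $b,c$ are regular. (vi) both $b,c$ are regular, $y=bb^{-}y$, $bb^{-}=yvawbb^{-}$, $yc^{-}c=y$, and $c^{-}c=c^{-}cvawy$. (vii) both $b,c$ are regular, $bb^{-}\in R(c^{-}cvawbb^{-})$, and $c^{-}c\in (c^{-}cvawbb^{-})R$. (viii) both $b,c$ are regular, and there exist $s,t\in R$ such that $bb^{-}=tc^{-}cvawbb^{-}$ and $c^{-}c=c^{-}cvawbb^{-}s$.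
   Context: The symbol $y$ in (i)–(vi) denotes an element of $R$. For $x\in R$: $xR=\{xr: r\in R\}$, $Rx=\{rx: r\in R\}$, $lann(x)=\{z\in R: zx=0\}$, $rann(x)=\{z\in R: xz=0\}$. An inner inverse of $x$ is an element $u\in R$ with $xux=x$; $x$ is called regular if such an element exists, and $x^{-}$ denotes an inner inverse of $x$. An element $y\in R$ satisfying $y\in bRwy\cap yvRc$, $yvawb=b$ and $cvawy=c$ is called the $(v,w)$-weighted $(b,c)$-inverse of $a$ and is denoted by $a^{v,w}_{b,c}$; it is unique if it exists. *)

(* Defs.v *)
From HB Require Import structures.
From mathcomp Require Import all_boot all_algebra.
From mathcomp Require Import boolp classical_sets.

Set Implicit Arguments.
Unset Strict Implicit.
Unset Printing Implicit Defensive.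

Import GRing.Theory.

Local Open Scope classical_set_scope.
Local Open Scope ring_scope.

(* [pzRingType] rather than [nzRingType]: the zero ring is not excluded. *)

Definition rideal (R : pzRingType) (x : R) : set R :=
  [set x * r | r in [set: R]].

Definition lideal (R : pzRingType) (x : R) : set R :=
  [set r * x | r in [set: R]].

Definition lann (R : pzRingType) (x : R) : set R := [set z | z * x = 0].

Definition rann (R : pzRingType) (x : R) : set R := [set z | x * z = 0].

Definition inner_inverse (R : pzRingType) (x u : R) : Prop := x * u * x = x.

(* Regularity in the sense of von Neumann, not cancellability
   ([GRing.lreg], [GRing.rreg]). *)
Definition vnregular (R : pzRingType) (x : R) : Prop :=
  exists u : R, inner_inverse x u.

(* A relation rather than a partial function of [a]: such a [y] need not
   exist, and it is unique when it does. *)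
Definition weighted_inverse (R : pzRingType) (v w b c a y : R) : Prop :=
  [/\ ([set b * r * w * y | r in [set: R]] `&`
       [set y * v * r * c | r in [set: R]]) y,
      y * v * a * w * b = b
    & c * v * a * w * y = c].

(* Main.v *)
(* Since [y * v * a * w * y = y], the elements [a * w] and [v * a] are inner
   inverses of [y * v] and [w * y].  For regular [x] with inner inverse [u], an
   element [z] with the same left annihilator satisfies [z = x * u * z], as
   [1 - x * u] annihilates [x]; so for regular elements equality of
   left annihilators yields equality of right ideals, and dually.  For the
   existence part, given [s] and [t] the inverse is
   [y = t * ci * c * v * a * w * b * bi * s], which equals both [b * bi * s]
   and [t * ci * c]. *)

Require Import Defs.
From HB Require Import structures.
From mathcomp Require Import all_boot all_algebra.
From mathcomp Require Import boolp classical_sets.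

Set Implicit Arguments.
Unset Strict Implicit.
Unset Printing Implicit Defensive.

Import GRing.Theory.

Local Open Scope classical_set_scope.
Local Open Scope ring_scope.

Section IdealsAndAnnihilators.
Variable R : pzRingType.
Implicit Types x y z u : R.

Lemma rideal_eq_lann x y : rideal x = rideal y -> lann x = lann y.
Proof.
have sub x' y' : rideal x' = rideal y' -> lann x' `<=` lann y'.
  move=> xy z; rewrite /lann /= => zx.
  have [r _ <-] : rideal x' y' by rewrite xy; exists 1; rewrite ?mulr1.
  by rewrite mulrA zx mul0r.
by move=> xy; apply/seteqP; split; apply: sub.
Qed.

Lemma lideal_eq_rann x y : lideal x = lideal y -> rann x = rann y.
Proof.
have sub x' y' : lideal x' = lideal y' -> rann x' `<=` rann y'.
  move=> xy z; rewrite /rann /= => xz.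
  have [r _ <-] : lideal x' y' by rewrite xy; exists 1; rewrite ?mul1r.
  by rewrite -mulrA xz mulr0.
by move=> xy; apply/seteqP; split; apply: sub.
Qed.

Lemma inner_inverse_lann x y u :
  inner_inverse x u -> lann x = lann y -> y = x * u * y.
Proof.
move=> xux xy.
have : lann y (1 - x * u) by rewrite -xy /lann /= mulrBl mul1r xux subrr.
by rewrite /lann /= mulrBl mul1r => /subr0_eq.
Qed.

Lemma inner_inverse_rann x y u :
  inner_inverse x u -> rann x = rann y -> y = y * u * x.
Proof.
move=> xux xy.
have : rann y (1 - u * x) by rewrite -xy /rann /= mulrBr mulr1 mulrA xux subrr.
by rewrite /rann /= mulrBr mulr1 mulrA => /subr0_eq.
Qed.

Lemma rideal_eq_mul x y p q : x = y * p -> y = x * q -> rideal x = rideal y.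
Proof.
move=> xE yE; apply/seteqP; split=> _ [r _ <-].
  by exists (p * r) => //; rewrite mulrA -xE.
by exists (q * r) => //; rewrite mulrA -yE.
Qed.

Lemma lideal_eq_mul x y p q : x = p * y -> y = q * x -> lideal x = lideal y.
Proof.
move=> xE yE; apply/seteqP; split=> _ [r _ <-].
  by exists (r * p) => //; rewrite -mulrA -xE.
by exists (r * q) => //; rewrite -mulrA -yE.
Qed.

Lemma inner_inverse_lann_rideal x y u z :
  inner_inverse x u -> inner_inverse y z -> lann x = lann y ->
  rideal x = rideal y.
Proof.
move=> xux yzy xy; apply: (@rideal_eq_mul _ _ (z * x) (u * y)).
  by rewrite mulrA; apply: inner_inverse_lann yzy (esym xy).
by rewrite mulrA; apply: inner_inverse_lann xux xy.
Qed.

(** With [x = y * p], the element [p * u] is an inner inverse of [y]: left multiplication by [x * u]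
    fixes [x], hence also [y], which has the same left annihilator. *)
Lemma rideal_eq_vnregular x y :
  rideal x = rideal y -> vnregular x -> vnregular y.
Proof.
move=> xy [u xux].
have [p _ xE] : rideal y x by rewrite -xy; exists 1; rewrite ?mulr1.
exists (p * u); rewrite /inner_inverse mulrA xE.
exact/esym/(inner_inverse_lann xux)/rideal_eq_lann.
Qed.

Lemma lideal_eq_vnregular x y :
  lideal x = lideal y -> vnregular x -> vnregular y.
Proof.
move=> xy [u xux].
have [p _ xE] : lideal y x by rewrite -xy; exists 1; rewrite ?mul1r.
exists (u * p); rewrite /inner_inverse -!mulrA xE mulrA.
exact/esym/(inner_inverse_rann xux)/lideal_eq_rann.
Qed.

End IdealsAndAnnihilators.

Section WeightedInverse.
Variables (R : pzRingType) (a b c w v : R).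

Lemma outer_inner_inverse y : y * v * a * w * y = y ->
  inner_inverse (y * v) (a * w) /\ inner_inverse (w * y) (v * a).
Proof.
by move=> yE; split; rewrite /inner_inverse ?mulrA ?yE // -[in RHS]yE !mulrA.
Qed.

Lemma weighted_inverse_ideals y : weighted_inverse v w b c a y ->
  [/\ y * v * a * w * y = y, rideal (y * v) = rideal b
    & lideal (w * y) = lideal c].
Proof.
move=> [[[r _ yr] [s _ ys]] bE cE]; split.
(* Left multiplication by [y * v * a * w] fixes [b], hence also [y = b * r * w * y]. *)
- by rewrite -{2}yr !mulrA bE yr.
- apply: (@rideal_eq_mul _ _ _ (r * w * y * v) (a * w * b)).
    by rewrite !mulrA yr.
  by rewrite !mulrA bE.
- apply: (@lideal_eq_mul _ _ _ (w * y * v * s) (c * v * a)).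
    by rewrite -!mulrA [y * _](_ : _ = y) // !mulrA.
  by rewrite !mulrA cE.
Qed.

Lemma weighted_inverse_inner bi ci y :
  inner_inverse b bi -> inner_inverse c ci ->
  y = b * bi * y -> b * bi = y * v * a * w * b * bi ->
  y * ci * c = y -> ci * c = ci * c * v * a * w * y ->
  weighted_inverse v w b c a y.
Proof.
move=> hb hc yb bE yc cE.
have yE : y * v * a * w * y = y.
  by rewrite {2}yb !mulrA -bE -yb.
split; first split.
(* Both memberships expand [y] as [y * v * a * w * y], with [b * bi] inserted on the left or
   [ci * c] on the right. *)
- by exists (bi * y * v * a) => //; rewrite !mulrA -yb.
- by exists (a * w * y * ci) => //; rewrite !mulrA yE.
- by rewrite -{1}hb !mulrA -bE hb.
- by have := congr1 ( *%R c) cE; rewrite !mulrA hc => /esym.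
Qed.

End WeightedInverse.

(* [bi] and [ci] stand for b^- and c^-: arbitrary inner inverses of b and c,
   constrained only when b, respectively c, is regular.
   Conditions (vii) and (viii) do not involve y; they are compared with the
   existence of the weighted inverse. *)
Theorem theorem3p4 (R : pzRingType) (a b c w v : R) (bi ci : R)
    (hbi : vnregular b -> inner_inverse b bi)
    (hci : vnregular c -> inner_inverse c ci) :
  (forall y : R,
    [<-> (* (i) *)
         weighted_inverse v w b c a y;
         (* (ii) *)
         [/\ y * v * a * w * y = y,
             rideal (y * v) = rideal b
           & lideal (w * y) = lideal c];
         (* (iii) *)
         [/\ y * v * a * w * y = y,
             lann (y * v) = lann b,
             lideal (w * y) = lideal c
           & vnregular b];
         (* (iv) *)
         [/\ y * v * a * w * y = y,
             rideal (y * v) = rideal b,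
             rann (w * y) = rann c
           & vnregular c];
         (* (v) *)
         [/\ y * v * a * w * y = y,
             lann (y * v) = lann b,
             rann (w * y) = rann c
           & vnregular b /\ vnregular c];
         (* (vi) *)
         [/\ vnregular b /\ vnregular c,
             y = b * bi * y,
             b * bi = y * v * a * w * b * bi,
             y * ci * c = y
           & ci * c = ci * c * v * a * w * y]])
  /\
  [<-> (* existence of y as in (i) *)
       exists y : R, weighted_inverse v w b c a y;
       (* (vii) *)
       [/\ vnregular b /\ vnregular c,
           lideal (ci * c * v * a * w * b * bi) (b * bi)
         & rideal (ci * c * v * a * w * b * bi) (ci * c)];
       (* (viii) *)
       [/\ vnregular b /\ vnregular c
         & exists s t : R,
             b * bi = t * ci * c * v * a * w * b * bi /\
             ci * c = ci * c * v * a * w * b * bi * s]].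
Proof.
have vi_i y : [/\ vnregular b /\ vnregular c, y = b * bi * y,
      b * bi = y * v * a * w * b * bi, y * ci * c = y
    & ci * c = ci * c * v * a * w * y] -> weighted_inverse v w b c a y.
  move=> [[rb rc] yb bE yc cE].
  exact: weighted_inverse_inner (hbi rb) (hci rc) yb bE yc cE.
have regb y : y * v * a * w * y = y -> rideal (y * v) = rideal b -> vnregular b.
  move=> /outer_inner_inverse[yv _] /rideal_eq_vnregular; apply.
  by exists (a * w).
have regc y : y * v * a * w * y = y -> lideal (w * y) = lideal c -> vnregular c.
  move=> /outer_inner_inverse[_ wy] /lideal_eq_vnregular; apply.
  by exists (v * a).
(* Serves both (v) to (vi) and existence to (vii). *)
have v_vi y : y * v * a * w * y = y -> lann (y * v) = lann b ->
    rann (w * y) = rann c -> vnregular b -> vnregular c ->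
  [/\ y = b * bi * y, b * bi = y * v * a * w * b * bi, y * ci * c = y
    & ci * c = ci * c * v * a * w * y].
  move=> yE lE rE rb rc; have [yv wy] := outer_inner_inverse yE.
  have yvE := inner_inverse_lann (hbi rb) (esym lE).
  have wyE := inner_inverse_rann (hci rc) (esym rE).
  have bE := inner_inverse_lann yv lE.
  have cE := inner_inverse_rann wy rE.
  split.
  (* [b * bi] fixes [y * v], which is a left factor of [y = y * v * a * w * y]; dually, [ci * c] is
     absorbed by the right factor [w * y]. *)
  - by rewrite -{2}yE !mulrA -[b * bi * y * v]mulrA -yvE yE.
  - by rewrite {1}bE !mulrA.
  - by rewrite -{1}yE -[RHS]yE -!mulrA [w * (y * _)]mulrA [w * y * _]mulrA -wyE.
  - by rewrite {1}cE !mulrA.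
split=> [y|]; tfae.
- exact: weighted_inverse_ideals.
- move=> [yE bE cE]; split=> //; first exact: rideal_eq_lann.
  exact: regb yE bE.
- move=> [yE bE cE [u hu]]; have [yv _] := outer_inner_inverse yE.
  split=> //; first exact: inner_inverse_lann_rideal yv hu bE.
    exact: lideal_eq_rann.
  exact: regc yE cE.
- move=> [yE bE cE rc]; split=> //; first exact: rideal_eq_lann.
  by split=> //; apply: regb yE bE.
- move=> [yE bE cE [rb rc]].
  by have [] := v_vi y yE bE cE rb rc; split.
- exact: vi_i.
- move=> [y /weighted_inverse_ideals[yE bE cE]].
  have [rb rc] := (regb _ yE bE, regc _ yE cE).
  have [yb bbE yc ccE] :=
    v_vi y yE (rideal_eq_lann bE) (lideal_eq_rann cE) rb rc.
  split=> //.
    (* The inverse [y] itself is the multiplier on both sides, because [y] absorbs [ci * c] on its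
       right and [b * bi] on its left. *)
    by exists y => //; rewrite !mulrA yc.
  by exists y => //; rewrite -[_ * b * bi]mulrA -[_ * (b * bi) * y]mulrA -yb.
- move=> [reg [t _ tE] [s _ sE]]; split=> //; exists s, t.
  by rewrite sE -{1}tE !mulrA.
- move=> [[rb rc] [s [t [tE sE]]]]; exists (b * bi * s); apply: vi_i.
  have yE : b * bi * s = t * ci * c.
    by rewrite tE -[RHS]mulrA sE !mulrA.
  have [hb hc] := (hbi rb, hci rc).
  (* The form [b * bi * s] gives the first and last equations, the form [t * ci * c] the two in
     between. *)
  split=> //.
  - by rewrite !mulrA hb.
  - by rewrite yE.
  - by rewrite yE -!mulrA (mulrA c) hc.
  - by rewrite !mulrA.
Qed.
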